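(* Let $r\geq 2$ and $n\geq 1$ be integers such that $n\cdot r$ is even, and let $K_{n,\ldots,n}$ be the complete balanced $r$-partite graph with $n$ vertices in each of its $r$ parts. Then $$W_{\tau}(K_{n,\ldots,n})\geq \left(\frac{3}{2}r-1\right)n+1.$$
   Context: All graphs are finite, undirected, without loops or multiple edges. The complete balanced $r$-partite graph $K_{n,\ldots,n}$ has vertex set partitioned into $r$ independent sets $V_1,\ldots,V_r$ with $|V_i|=n$ for all $i$, and every vertex of $V_i$ is adjacent to every vertex of $V_j$ whenever $i\neq j$. A total coloring of a graph $G$ is a coloring of its vertices and edges such that no two adjacent vertices, no two adjacent edges, and no vertex and edge incident to each other get the same color. For a total coloring $\alpha$ and a vertex $v$, $S[v,\alpha]$ denotes the set consisting of $\alpha(v)$ and the colors of all edges incident to $v$. For a positive integer $t$, an interval total $t$-coloring of $G$ is a total coloring $\alpha$ of $G$ with colors $1,\ldots,t$ such that all $t$ colors are used (each on at least one vertex or edge), and for every vertex $v$ the set $S[v,\alpha]$ is an interval of integers (a set of consecutive integers). $G$ is interval total colorable if it has an interval total $t$-coloring for some positive integer $t$. For an interval total colorable graph $G$, $W_{\tau}(G)$ denotes the greatest value of $t$ for which $G$ has an interval total $t$-coloring. (All complete balanced multipartite graphs are interval total colorable, so $W_{\tau}(K_{n,\ldots,n})$ is defined.) *)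

(* Defs.v *)
From mathcomp Require Import all_boot all_order all_algebra.
From mathcomp Require Import boolp.
Set Implicit Arguments.
Unset Strict Implicit.
Unset Printing Implicit Defensive.

Record sgraph := SGraph {
  vertex :> finType;
  adj : rel vertex;
  adj_sym : symmetric adj;
  adj_irrefl : irreflexive adj }.

Definition edges (G : sgraph) : {set {set G}} :=
  [set [set p.1; p.2] | p : G * G & adj p.1 p.2].

Definition edge (G : sgraph) : Type := {e : {set G} | e \in edges G}.

(* A colouring of the vertices (inl) and edges (inr) of G. *)
Definition coloring (G : sgraph) := (G + edge G)%type -> nat.

Definition total_coloring (G : sgraph) (alpha : coloring G) : Prop :=
  [/\ forall u v : G, adj u v -> alpha (inl u) <> alpha (inl v),
      forall e f : edge G, e <> f -> val e :&: val f != set0 ->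
        alpha (inr e) <> alpha (inr f)
    & forall (v : G) (e : edge G), v \in val e ->
        alpha (inl v) <> alpha (inr e)].

(* The set S[v, alpha], as a list. *)
Definition spectrum (G : sgraph) (alpha : coloring G) (v : G) : seq nat :=
  alpha (inl v) ::
    [seq alpha (inr e) | e : edge G <- enum {: edge G} & v \in val e].

Definition is_interval (s : seq nat) : Prop :=
  exists a b : nat, forall k : nat, (k \in s) = (a <= k <= b).

Definition interval_total_coloring (G : sgraph) (t : nat) (alpha : coloring G)
    : Prop :=
  [/\ total_coloring alpha,
      forall z, 1 <= alpha z <= t,
      forall k, 1 <= k <= t -> exists z, alpha z = k
    & forall v : G, is_interval (spectrum alpha v)].

Definition has_interval_total_coloring (G : sgraph) (t : nat) : Prop :=
  0 < t /\ exists alpha : coloring G, interval_total_coloring t alpha.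

Definition interval_total_colorable (G : sgraph) : Prop :=
  exists t : nat, has_interval_total_coloring G t.

(* The greatest t such that G has an interval total t-colouring. Since every
   colour is used, t is at most the number of vertices and edges, so the search
   bound loses nothing: see [W_tau_max] and [W_tau_attained]. The value is 0
   when G is not interval total colorable. *)
Definition W_tau (G : sgraph) : nat :=
  \max_(t < (#|G| + #|edges G|).+1 | `[< has_interval_total_coloring G t >]) t.

Lemma interval_total_coloring_bound (G : sgraph) (t : nat) :
  has_interval_total_coloring G t -> t <= #|G| + #|edges G|.
Proof.
case=> _ [alpha [_ _ surj _]].
have -> : #|G| + #|edges G| = size (codom alpha).
  by rewrite size_codom card_sum card_sig.
rewrite -[leqLHS](size_iota 1); apply: uniq_leq_size (iota_uniq _ _) _ => k.
rewrite mem_iota add1n ltnS => /surj[z <-]; exact: codom_f.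
Qed.

Lemma W_tau_max (G : sgraph) (t : nat) :
  has_interval_total_coloring G t -> t <= W_tau G.
Proof.
move=> Gt; have := interval_total_coloring_bound Gt; rewrite -ltnS => lt_t.
apply: (@leq_bigmax_cond _ _ (fun i => nat_of_ord i) (Ordinal lt_t)).
exact/asboolP.
Qed.

Lemma W_tau_attained (G : sgraph) :
  interval_total_colorable G -> has_interval_total_coloring G (W_tau G).
Proof.
case=> t Gt; have := interval_total_coloring_bound Gt; rewrite -ltnS => lt_t.
rewrite /W_tau (@bigop.bigmax_eq_arg _ (Ordinal lt_t)); last exact/asboolP.
by case: arg_maxnP => [|i /asboolP //]; exact/asboolP.
Qed.

Definition multipartite_adj (r n : nat) : rel ('I_r * 'I_n) :=
  fun u v => u.1 != v.1.

Lemma multipartite_adj_sym (r n : nat) : symmetric (@multipartite_adj r n).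
Proof. by move=> u v; rewrite /multipartite_adj eq_sym. Qed.

Lemma multipartite_adj_irrefl (r n : nat) : irreflexive (@multipartite_adj r n).
Proof. by move=> u; rewrite /multipartite_adj eqxx. Qed.

(* K_{n,...,n} with r parts; the i-th part is {i} x 'I_n. *)
Definition complete_balanced_multipartite (r n : nat) : sgraph :=
  SGraph (@multipartite_adj_sym r n) (@multipartite_adj_irrefl r n).

(* Main.v *)
(* Pair the vertices of a 2N-vertex graph as (u_i, w_i), i < N. Let a coloring
   give both u_i and w_i the edge spectrum [i, i + d - 1]; coloring u_i just
   below and w_i just above its edges makes all vertex colors distinct and
   extends the coloring to an interval total coloring with N + d + 1 colors.
   On the complete graph, color u_i u_j and w_i w_j (and u_i w_i when i = j) by
   i + j if i + j < N, and by i + j + M otherwise; the N - 1 matchings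
   {u_i w_(i + s mod N)} with 0 < s < N get the colors in between. All these
   matchings are kept for r = 2N and n = 1 (M = N - 1), and the last one is
   dropped for r = N and n = 2 (M = N - 2). Finally every vertex is replaced by
   k copies, and an edge of color c by a K_{k,k} whose edge between the copies
   a and b has color c k + a + b. *)
Require Import Defs.
From mathcomp Require Import all_boot all_order all_algebra.
From mathcomp Require Import zify ring.
Import Order.TTheory GRing.Theory Num.Theory.

(** * From color functions to interval total colorings *)

(** The maximum makes a value on unordered pairs without choosing an orientation: for a symmetric
    [ec] both orderings contribute the same number. *)
Definition edge_color {G : sgraph} (ec : G -> G -> nat) (e : {set G}) : nat :=
  \max_(p : G * G | (p.1 != p.2) && (e == [set p.1; p.2])) ec p.1 p.2.

Lemma set2_eq (T : finType) (a b u v : T) :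
  [set a; b] = [set u; v] -> (a = u /\ b = v) \/ (a = v /\ b = u).
Proof.
move=> E.
have := set21 a b; have := set22 a b; rewrite E !inE.
have := set21 u v; have := set22 u v; rewrite -E !inE.
by do 4![case/orP=> /eqP ?]; subst; auto.
Qed.

Lemma edge_color_set2 (G : sgraph) (ec : G -> G -> nat) (u v : G) :
  (forall x y, ec x y = ec y x) -> u != v -> edge_color ec [set u; v] = ec u v.
Proof.
move=> ecC uv; apply/eqP; rewrite eqn_leq; apply/andP; split.
  by apply/bigmax_leqP => -[a b] /= /andP[_ /eqP/set2_eq[][-> ->]] //; rewrite ecC.
apply: (@leq_bigmax_cond _ _ (fun p : G * G => ec p.1 p.2) (u, v)).
by rewrite /= uv eqxx.
Qed.

Lemma edgeP (G : sgraph) (e : edge G) (v : G) :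
  v \in val e -> exists2 u, adj v u & val e = [set v; u].
Proof.
case: e => e /= /imsetP[[a b]]; rewrite inE /= => ab ->.
rewrite !inE => /orP[] /eqP ->; first by exists b.
by exists a; [rewrite adj_sym | rewrite setUC].
Qed.

Lemma mem_edges (G : sgraph) (u v : G) : adj u v -> [set u; v] \in edges G.
Proof. by move=> uv; apply/imsetP; exists (u, v); rewrite ?inE. Qed.

Lemma adj_neq (G : sgraph) (u v : G) : adj u v -> u != v.
Proof. by apply: contraTneq => ->; rewrite adj_irrefl. Qed.

(** Every color occurs in some spectrum, so describing the union of the intervals [[lo v, hi v]] as
    [[1, t]] yields both that colors stay in range and that all are used. *)
Lemma interval_total_coloring_of_functions (G : sgraph) (t : nat)
    (vc : G -> nat) (ec : G -> G -> nat) (lo hi : G -> nat) :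
  0 < t ->
  (forall u v, ec u v = ec v u) ->
  (forall u v, adj u v -> vc u <> vc v) ->
  (forall u v, adj u v -> vc u <> ec u v) ->
  (forall u v w, adj u v -> adj u w -> ec u v = ec u w -> v = w) ->
  (forall v k, (lo v <= k <= hi v) <->
               (k = vc v \/ exists2 u, adj v u & ec v u = k)) ->
  (forall k, (1 <= k <= t) <-> (exists v, lo v <= k <= hi v)) ->
  has_interval_total_coloring G t.
Proof.
move=> t0 ecC vcP vecP ecP specP rangeP; split=> //.
pose alpha : coloring G := fun z =>
  match z with inl v => vc v | inr e => edge_color ec (val e) end.
have alphaE u v (e : edge G) : adj u v -> val e = [set u; v] ->
    alpha (inr e) = ec u v.
  by move=> uv /= ->; rewrite edge_color_set2 // adj_neq.
pose mk u v (uv : adj u v) : edge G := exist _ [set u; v] (mem_edges _ _ _ uv).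
have mem_spec v k : k \in spectrum alpha v <-> lo v <= k <= hi v.
  rewrite specP inE; split.
    case/orP=> [/eqP|]; first by left.
    case/mapP=> e; rewrite mem_filter => /andP[ve _] ->; right.
    have [u vu eE] := edgeP _ _ _ ve; exists u => //.
    by rewrite (alphaE v u).
  case=> [->|[u vu <-]]; first by rewrite eqxx.
  apply/orP; right; apply/mapP; exists (mk _ _ vu).
    by rewrite mem_filter mem_enum set21.
  by rewrite (alphaE v u).
have mem_spec_inr (e : edge G) : exists v, alpha (inr e) \in spectrum alpha v.
  case/imsetP: (valP e) => -[a b]; rewrite inE /= => ab eE.
  have ae : a \in val e by rewrite /= eE set21.
  exists a; rewrite inE; apply/orP; right; apply: map_f.
  by rewrite mem_filter mem_enum ae.
exists alpha; split.
- split=> [u v uv|e f ef|v e ve]; first exact: vcP.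
    case/set0Pn=> v; rewrite inE => /andP[/edgeP[u vu eE] /edgeP[w vw fE]].
    rewrite (alphaE v u) // (alphaE v w) // => /ecP uw.
    by apply: ef; apply: val_inj; rewrite eE fE uw.
  by have [u vu eE] := edgeP _ _ _ ve; rewrite (alphaE v u) //=; apply: vecP.
- move=> z; apply/rangeP; case: z => [v|e].
    by exists v; rewrite -mem_spec inE eqxx.
  by have [v /mem_spec] := mem_spec_inr e; exists v.
- move=> k /rangeP[v /specP[->|[u vu <-]]]; first by exists (inl v).
  by exists (inr (mk _ _ vu)); apply: alphaE.
by move=> v; exists (lo v), (hi v) => k; apply/idP/idP => /mem_spec.
Qed.

(** Pigeonhole: with it, a degree count replaces the search for an edge of each given color at a
    vertex. *)
Lemma surjective_onto_interval (T : finType) (A : {pred T}) (f : T -> nat)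
    (m d : nat) :
  {in A &, injective f} -> {in A, forall x, m <= f x < m + d} -> #|A| = d ->
  forall k, m <= k < m + d -> exists2 x, x \in A & f x = k.
Proof.
move=> f_inj f_range cardA k; rewrite -mem_iota.
have uniq_f : uniq [seq f x | x <- enum A].
  rewrite map_inj_in_uniq ?enum_uniq // => x y.
  by rewrite !mem_enum; apply: f_inj.
have sub_f : {subset [seq f x | x <- enum A] <= iota m d}.
  by move=> _ /mapP[x + ->]; rewrite mem_enum mem_iota; apply: f_range.
have [|_ <-] := uniq_min_size uniq_f sub_f.
  by rewrite size_iota size_map -cardE cardA.
by case/mapP=> x; rewrite mem_enum => xA ->; exists x.
Qed.

(** * The base coloring *)

(** For [i, j < N] this is the residue of [j - i] modulo [N] taken in 1, ..., [N]: the index s of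
    the matching joining u_i to w_j when [i] and [j] differ. *)
Definition cyc_dist (N i j : nat) : nat := if i < j then j - i else N + j - i.

(* [s x] tells whether x is a copy of w_i or of u_i. *)
Definition base_color (N M : nat) (s : bool) (i : nat) (s' : bool) (j : nat) :=
  if (s == s') || (i == j) then
    if i + j < N then i + j else i + j + M
  else (N + (if s then cyc_dist N j i else cyc_dist N i j)).-1.

Lemma base_colorC N M s i s' j :
  base_color N M s i s' j = base_color N M s' j s i.
Proof.
rewrite /base_color (eq_sym s') (eq_sym j) (addnC j).
by case: s s' => [] [].
Qed.

(** The pairs that may be joined: among the matchings only those with s at most [M] are allowed. *)
Definition compatible (N M : nat) (s : bool) (i : nat) (s' : bool) (j : nat) :=
  if s == s' then i != j
  else (i == j) || ((if s then cyc_dist N j i else cyc_dist N i j) <= M).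

(** The sums [i + j] lie in [[i, i + N - 1]]; moving those from [N] on up by [M] opens a gap
    [[N, N + M - 1]] for the matchings. *)
Lemma base_color_range N M s i s' j :
  i < N -> j < N -> compatible N M s i s' j ->
  i <= base_color N M s i s' j < i + (N + M).
Proof.
rewrite /compatible /base_color /cyc_dist => iN jN.
by case: s s' => [] [] /=; do ![case: ifP => //]; lia.
Qed.

(** Small sums, matchings and shifted sums use disjoint ranges of colors, and within each range the
    color determines the neighbor. *)
Lemma base_color_inj N M s i s1 j1 s2 j2 :
  i < N -> j1 < N -> j2 < N ->
  compatible N M s i s1 j1 -> compatible N M s i s2 j2 ->
  base_color N M s i s1 j1 = base_color N M s i s2 j2 -> s1 = s2 /\ j1 = j2.
Proof.
rewrite /compatible /base_color /cyc_dist => iN j1N j2N.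
by case: s s1 s2 => [] [] [] /=; do ![case: ifP => //]; lia.
Qed.

(** * Replacing vertices by copies *)

Lemma mulnD_inj k a b x y : a < k -> b < k ->
  x * k + a = y * k + b -> x = y /\ a = b.
Proof.
move=> ak bk E; have k0 : 0 < k by apply: leq_ltn_trans ak.
have := congr1 (divn^~ k) E; rewrite !divnMDl // !divn_small // !addn0 => xy.
by split=> //; move: E; rewrite xy => /addnI.
Qed.

Lemma mulnD_range k a b x y z : b < k -> x <= y < x + z ->
  x * k + a + 2 <= y * k + a + b + 2 < x * k + a + 2 + z * k.
Proof. by move=> bk /andP[xy yz]; nia. Qed.

Lemma has_interval_total_coloring_of_pairs (G : sgraph) (N M k : nat)
    (sd : G -> bool) (ix off : G -> nat) :
  0 < k -> 0 < N ->
  (forall x, ix x < N) -> (forall x, off x < k) ->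
  (forall x y, sd x = sd y -> ix x = ix y -> off x = off y -> x = y) ->
  (forall s i a, i < N -> a < k -> exists x, [/\ sd x = s, ix x = i & off x = a]) ->
  (forall x y, adj x y -> compatible N M (sd x) (ix x) (sd y) (ix y)) ->
  (forall x, #|[pred y : G | adj x y]| = (N + M) * k) ->
  has_interval_total_coloring G ((2 * N + M) * k + 1).
Proof.
move=> k0 N0 ixN offk xinj xsurj adjP degP.
pose d := (N + M) * k.
pose q x := ix x * k + off x.
have qN x : q x < N * k by rewrite /q; have := ixN x; have := offk x; nia.
(* The shift by 2 puts the edge colors at [x] in [[q x + 2, q x + d + 1]], leaving color 1 for copy
   0 of u_0. *)
pose ec x y := base_color N M (sd x) (ix x) (sd y) (ix y) * k
               + off x + off y + 2.
pose vc x := if sd x then q x + d + 2 else q x + 1.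
pose lo x := if sd x then q x + 2 else q x + 1.
have ec_inj u v w : adj u v -> adj u w -> ec u v = ec u w -> v = w.
  move=> uv uw E.
  (* After cancelling [off u], the base color and the offset of the neighbor are quotient and
     remainder modulo [k]. *)
  have [] := mulnD_inj k (off v) (off w)
    (base_color N M (sd u) (ix u) (sd v) (ix v))
    (base_color N M (sd u) (ix u) (sd w) (ix w)) (offk _) (offk _).
    by move: E; rewrite /ec; lia.
  by move/(base_color_inj _ _ _ _ _ _ _ _ (ixN _) (ixN _) (ixN _)
             (adjP _ _ uv) (adjP _ _ uw)) => [? ?] ?; apply: xinj.
have ec_range u v : adj u v -> q u + 2 <= ec u v < q u + 2 + d.
  move=> uv; apply: mulnD_range => //.
  by apply: base_color_range => //; apply: adjP.
have ec_onto u c : q u + 2 <= c < q u + 2 + d -> exists2 v, adj u v & ec u v = c.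
  apply: (surjective_onto_interval _ [pred y : G | adj u y]) (degP u) c.
    by move=> v w /=; apply: ec_inj.
  by move=> v /=; apply: ec_range.
have dE : (2 * N + M) * k = N * k + d by rewrite /d; lia.
apply: (interval_total_coloring_of_functions _ _ vc ec lo
          (fun x => lo x + d)).
- by rewrite addn1.
- by move=> u v; rewrite /ec base_colorC; lia.
- move=> u v /adj_neq /eqP uv E; apply: uv.
  (* Copies of the u_i have vertex colors at most [N * k], copies of the w_i at least [d + 2], and
     [N * k <= d]. *)
  have : (sd u = sd v) /\ q u = q v.
    move: E; rewrite /vc; have := qN u; have := qN v; rewrite /d.
    by case: (sd u); case: (sd v); nia.
  by case=> ss /(mulnD_inj k _ _ _ _ (offk _) (offk _)) [? ?]; apply: xinj.
- move=> u v /ec_range; rewrite /vc; case: (sd u); lia.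
- exact: ec_inj.
- move=> v c; split=> [cP|]; last first.
    by case=> [->|[u /ec_range + <-]]; rewrite /lo /vc; case: (sd v); lia.
  case: (eqVneq c (vc v)) => [|/eqP cv]; [by left | right].
  by apply: ec_onto; move: cP cv; rewrite /lo /vc; case: (sd v); lia.
move=> c; rewrite dE; split=> [cP|[x]]; last first.
  by have := qN x; rewrite /lo; case: (sd x); lia.
(* Copy 0 of u_0 sees 1, ..., [d + 1]; any larger [c] is the vertex color of the copy of some w_i
   with [q x = c - (d + 2)]. *)
case: (leqP c d.+1) => cd.
  have [x [sx ix0 o0]] := xsurj false 0 0 N0 k0.
  by exists x; rewrite /lo sx /q ix0 o0; lia.
have [||x [sx ixE oE]] := xsurj true ((c - d.+2) %/ k) ((c - d.+2) %% k).
- by rewrite ltn_divLR //; lia.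
- by rewrite ltn_mod.
by exists x; rewrite /lo sx /q ixE oE -divn_eq; lia.
Qed.

(** * The two cases *)

Lemma degree_complete_balanced_multipartite (r n : nat)
    (x : complete_balanced_multipartite r n) :
  #|[pred y : complete_balanced_multipartite r n | adj x y]| = r.-1 * n.
Proof.
rewrite -[X in _ * X]card_ord -[in r.-1](card_ord r) (cardD1 x.1) /=.
rewrite -cardX; apply: eq_card => -[i a].
by rewrite !inE /multipartite_adj eq_sym !andbT.
Qed.

(** Parts 2i and 2i + 1 are the copies of u_i and of w_i. Distinct indices have cyclic distance at
    most m - 1, so no matching is lost. *)
Lemma coloring_even_parts (m n : nat) : 0 < m -> 0 < n ->
  has_interval_total_coloring (complete_balanced_multipartite m.*2 n)
    ((3 * m).-1 * n + 1).
Proof.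
move=> m0 n0; have -> : (3 * m).-1 = 2 * m + m.-1 by lia.
pose G := complete_balanced_multipartite m.*2 n.
apply: (has_interval_total_coloring_of_pairs G m m.-1 n
  (fun x => odd x.1) (fun x => x.1./2) (fun x => x.2)) => //.
- by case=> i a /=; have := ltn_ord i; lia.
- move=> [i a] [j b] /= ij1 ij2 ab; congr pair; apply: val_inj => //=.
  by rewrite -(odd_double_half i) ij1 ij2 odd_double_half.
- move=> s i a im an; have si : s + i.*2 < m.*2 by case: s; lia.
  exists (Ordinal si, Ordinal an); split=> //=; first by case: s {si}; lia.
  by case: s {si}; lia.
- move=> [i a] [j b] /=; rewrite /multipartite_adj /compatible /cyc_dist /=.
  have := ltn_ord i; have := ltn_ord j; rewrite -val_eqE /=.
  by do ![case: ifP]; lia.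
by move=> x; rewrite degree_complete_balanced_multipartite; congr (_ * _); lia.
Qed.

(* The part with index I consists of the copies of u_I and of w_(I - 1). *)
Lemma coloring_even_part_size (r k : nat) : 1 < r -> 0 < k ->
  has_interval_total_coloring (complete_balanced_multipartite r k.*2)
    ((3 * r - 2) * k + 1).
Proof.
move=> r1 k0; have -> : 3 * r - 2 = 2 * r + (r - 2) by lia.
pose G := complete_balanced_multipartite r k.*2.
pose ix (x : G) := if odd x.2 then (if x.1 == 0 :> nat then r.-1 else x.1.-1)
                   else x.1 : nat.
apply: (has_interval_total_coloring_of_pairs G r (r - 2) k
  (fun x => odd x.2) ix (fun x => x.2./2)) => //.
- exact: ltnW.
- by case=> i a; rewrite /ix /=; have := ltn_ord i; do ![case: ifP]; lia.
- by case=> i a /=; have := ltn_ord a; lia.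
- move=> [i a] [j b]; rewrite /ix /= => ab1 ij ab2.
  congr pair; apply: val_inj => /=; last first.
    by rewrite -(odd_double_half a) ab1 ab2 odd_double_half.
  move: ij; rewrite ab1; have := ltn_ord i; have := ltn_ord j.
  by do ![case: ifP]; lia.
- move=> s i a ir ak; have sa : s + a.*2 < k.*2 by case: s; lia.
  have pr : (if s then (if i.+1 == r then 0 else i.+1) else i) < r.
    by do ![case: ifP]; lia.
  exists (Ordinal pr, Ordinal sa); rewrite /ix /=.
  by case: s {sa pr} => /=; split; do ?[case: ifP]; lia.
(* The excluded distance r - 1 leads from u_I to w_(I - 1), which share a part and are thus not
   adjacent. *)
- move=> [i a] [j b] /=.
  rewrite /multipartite_adj /compatible /cyc_dist /ix /= -val_eqE /=.
  have := ltn_ord i; have := ltn_ord j.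
  by case: (odd a); case: (odd b) => /=; do ?[case: ifP]; lia.
by move=> x; rewrite degree_complete_balanced_multipartite; nia.
Qed.

Local Open Scope ring_scope.

Theorem theorem11 (r n : nat) (hr : (2 <= r)%N) (hn : (1 <= n)%N)
    (hnr : ~~ odd (n * r)%N) :
  (3 / 2 * r%:R - 1) * n%:R + 1
    <= (W_tau (complete_balanced_multipartite r n))%:R :> rat.
Proof.
(* Both colorings meet the bound exactly: it is (3m - 1)n + 1 for r = 2m and (3r - 2)k + 1 for n =
   2k. *)
have [r_even|r_odd] := boolP (~~ odd r).
  have rE : r = (r./2).*2 by rewrite even_halfK.
  have m0 : (0 < r./2)%N by lia.
  have := W_tau_max (coloring_even_parts _ _ m0 hn); rewrite -rE => le_W.
  apply: le_trans (_ : (_ : nat)%:R <= _); last by rewrite ler_nat; exact: le_W.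
  rewrite {1}rE natrD natrM -subn1 natrB -1?muln2 ?natrM; last by lia.
  by rewrite le_eqVlt; apply/orP; left; apply/eqP; field.
have nE : n = (n./2).*2.
  by rewrite even_halfK //; move: hnr r_odd; rewrite oddM; case: odd => //= ->.
have k0 : (0 < n./2)%N by lia.
have := W_tau_max (coloring_even_part_size _ _ hr k0); rewrite -nE => le_W.
apply: le_trans (_ : (_ : nat)%:R <= _); last by rewrite ler_nat; exact: le_W.
rewrite {1}nE natrD natrM natrB -1?muln2 ?natrM; last by lia.
by rewrite le_eqVlt; apply/orP; left; apply/eqP; field.
Qed.
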